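(* Let $(V;\rho^L,\rho^R)$ be a representation of a Leibniz algebra $(\mathfrak g,[\cdot,\cdot]_{\mathfrak g})$ and let $K:V\to\mathfrak g$ be a linear map with dual map $K^*:\mathfrak g^*\to V^*$. Let $K+K^*:\mathfrak g^*\oplus V\to\mathfrak g\oplus V^*$ be the map $\xi+v\mapsto K(v)+K^*(\xi)$. Then $K$ is a relative Rota–Baxter operator on $\mathfrak g$ with respect to $(V;\rho^L,\rho^R)$ if and only if $K+K^*$ is a relative Rota–Baxter operator on the Leibniz algebra $\mathfrak g\ltimes_{(\rho^L)^*,-(\rho^L)^*-(\rho^R)^*}V^*$ with respect to the dual representation $(\mathfrak g^*\oplus V;L^*_\ltimes,-L^*_\ltimes-R^*_\ltimes)$ of its regular representation $(\mathfrak g\oplus V^*;L_\ltimes,R_\ltimes)$; that is, the tensor form $\overline{K+K^*}=\Upsilon(K+K^* )$ is a solution of the classical Leibniz Yang–Baxter equation in the Leibniz algebra $\mathfrak g\ltimes_{(\rho^L)^*,-(\rho^L)^*-(\rho^R)^*}V^*$.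
   Context: All vector spaces are finite-dimensional over an algebraically closed field $\mathbb K$ of characteristic $0$. A Leibniz algebra is a vector space with a bilinear operation satisfying $[x,[y,z]]=[[x,y],z]+[y,[x,z]]$. A representation of a Leibniz algebra $\mathfrak g$ is $(V;\rho^L,\rho^R)$ with linear maps $\rho^L,\rho^R:\mathfrak g\to\mathfrak{gl}(V)$ such that $\rho^L([x,y])=[\rho^L(x),\rho^L(y)]$, $\rho^R([x,y])=[\rho^L(x),\rho^R(y)]$, $\rho^R(y)\rho^L(x)=-\rho^R(y)\rho^R(x)$. For a linear map $\rho:\mathfrak g\to\mathfrak{gl}(V)$, $\rho^*:\mathfrak g\to\mathfrak{gl}(V^* )$ is $\langle\rho^*(x)\chi,v\rangle=-\langle\chi,\rho(x)v\rangle$. The dual representation of $(V;\rho^L,\rho^R)$ is $(V^*;(\rho^L)^*,-(\rho^L)^*-(\rho^R)^* )$. The semidirect product $\mathfrak g\ltimes_{\rho^L,\rho^R}V$ is $\mathfrak g\oplus V$ with bracket $[x+u,y+v]_\ltimes=[x,y]_{\mathfrak g}+\rho^L(x)v+\rho^R(y)u$; here it is applied to the dual representation on $V^*$. The regular representation of a Leibniz algebra $\mathfrak h$ is $(\mathfrak h;L,R)$ with $L_xy=[x,y]$, $R_xy=[y,x]$; $L_\ltimes,R_\ltimes$ are the left and right multiplications of $\mathfrak g\ltimes_{(\rho^L)^*,-(\rho^L)^*-(\rho^R)^*}V^*$, and $(\mathfrak g\oplus V^* )^*$ is identified with $\mathfrak g^*\oplus V$. A relative Rota–Baxter operator on $\mathfrak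 g$ with respect to $(V;\rho^L,\rho^R)$ is a linear map $K:V\to\mathfrak g$ with $[Kv_1,Kv_2]_{\mathfrak g}=K(\rho^L(Kv_1)v_2+\rho^R(Kv_2)v_1)$. The dual map is $\langle K^*\xi,v\rangle=\langle\xi,Kv\rangle$. For a Leibniz algebra $\mathfrak h$ and linear $f:\mathfrak h^*\to\mathfrak h$, $\Upsilon(f)\in\mathfrak h\otimes\mathfrak h$ is $\langle\Upsilon(f),\xi\otimes\eta\rangle=\langle f(\xi),\eta\rangle$. The classical Leibniz Yang–Baxter equation for $r\in\mathrm{Sym}^2(\mathfrak h)$ is $[[r,r]]=0$, where $\langle[[\Upsilon(f),\Upsilon(g)]],\xi_1\otimes\xi_2\otimes\xi_3\rangle=\langle\{f,g\}(\xi_1,\xi_2),\xi_3\rangle$ and $$\{f,g\}(\xi_1,\xi_2)=-f(L^*_{g\xi_1}\xi_2)+f(L^*_{g\xi_2}\xi_1)+f(R^*_{g\xi_2}\xi_1)+[g\xi_1,f\xi_2]_{\mathfrak h}+[f\xi_1,g\xi_2]_{\mathfrak h}-g(L^*_{f\xi_1}\xi_2)+g(L^*_{f\xi_2}\xi_1)+g(R^*_{f\xi_2}\xi_1).$$ *)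

(* Defs.v *)
From HB Require Import structures.
From mathcomp Require Import all_boot all_order all_algebra.
From mathcomp Require Import ring.
Set Implicit Arguments.
Unset Strict Implicit.
Unset Printing Implicit Defensive.
Import GRing.Theory.
Local Open Scope ring_scope.

(* V^* = 'Hom(V, F^o); naming the vectType instance of F^o directly avoids the
   reverse coercions that make unification very slow. *)
Notation dual V := 'Hom(V, GRing_regular__canonical__vector_Vector _).

(* As all spaces are finite-dimensional, U (x) V is realized as the space of
   bilinear forms on U^* x V^*, with <t, xi (x) eta> = t xi eta; lemma
   tensor_universal is its universal property.  Likewise for three factors. *)
Notation tensor U V := 'Hom(dual U, dual (dual V)).
Notation tensor3 U V W := 'Hom(dual U, 'Hom(dual V, dual (dual W))).

Section LinearAlgebra.
Context {F : fieldType}.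
Implicit Types U V W : vectType F.

Lemma linfun_val U V (f : U -> V) : linear f -> linfun f =1 f.
Proof.
move=> f_lin x.
pose fL := GRing.isLinear.Build F U V *:%R f f_lin.
pose fP : {linear U -> V} := HB.pack f fL.
exact: (lfunE fP).
Qed.

(* linfun f is meaningful only for linear f; bilinE is the corresponding fact
   for bilin. *)
Definition bilin U V W (f : U -> V -> W) : 'Hom(U, 'Hom(V, W)) :=
  linfun (fun u => linfun (f u)).

Lemma bilinE U V W (f : U -> V -> W) :
  (forall u, linear (f u)) -> (forall v, linear (f^~ v)) ->
  forall u v, bilin f u v = f u v.
Proof.
move=> fr fl u v; rewrite /bilin linfun_val ?linfun_val//.
move=> a x y; apply/lfunP=> w.
by rewrite add_lfunE scale_lfunE !linfun_val// fl.
Qed.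

Definition ev V : 'Hom(V, dual (dual V)) := bilin (fun v (chi : dual V) => chi v).

Lemma evE V (v : V) (chi : dual V) : ev V v chi = chi v.
Proof.
rewrite bilinE// => [u|u] a x y; first by rewrite add_lfunE scale_lfunE.
by rewrite linearP.
Qed.

Definition coordf V (i : 'I_(\dim {:V})) : dual V :=
  linfun (fun v => coord (vbasis {:V}) i v : F^o).

Lemma coordfE V i (v : V) : coordf i v = coord (vbasis {:V}) i v.
Proof. by rewrite linfun_val// => a x y; rewrite linearP. Qed.

Lemma coordf_basis V (i j : 'I_(\dim {:V})) : coordf i (vbasis {:V})`_j = (i == j)%:R.
Proof. by rewrite coordfE coord_free ?(basis_free (vbasisP _))// eq_sym. Qed.

Lemma sum_coordf V (v : V) : v = \sum_(i < \dim {:V}) coordf i v *: (vbasis {:V})`_i.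
Proof.
rewrite {1}(coord_basis (vbasisP {:V}) (memvf v)).
by apply: eq_bigr => i _; rewrite coordfE.
Qed.

Lemma sum_dual V (chi : dual V) : chi = \sum_(i < \dim {:V}) chi (vbasis {:V})`_i *: coordf i.
Proof.
apply/lfunP => v; rewrite {1}(sum_coordf v) linear_sum sum_lfunE.
by apply: eq_bigr => i _; rewrite linearZ scale_lfunE /GRing.scale /= mulrC.
Qed.

Lemma ev_inj V : lker (ev V) == 0%VS.
Proof.
apply/lker0P => u v /lfunP euv; rewrite (sum_coordf u) (sum_coordf v).
by apply: eq_bigr => i _; move: (euv (coordf i)); rewrite !evE => ->.
Qed.

Lemma dual_ext V (u v : V) : (forall chi : dual V, chi u = chi v) -> u = v.
Proof.
move=> uv; apply: (lker0P (ev_inj V)); apply/lfunP => chi.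
by rewrite !evE.
Qed.

Lemma ev_full V : limg (ev V) = fullv.
Proof.
apply/eqP; rewrite eqEsubv subvf; apply/subvP => f _; apply/memv_imgP.
exists (\sum_(i < \dim {:V}) f (coordf i) *: (vbasis {:V})`_i); first exact: memvf.
apply/lfunP => chi; rewrite evE {1}(sum_dual chi) !linear_sum.
by apply: eq_bigr => i _; rewrite !linearZ; exact: mulrC.
Qed.

Lemma ev_invE V (f : dual (dual V)) (chi : dual V) : chi ((ev V)^-1%VF f) = f chi.
Proof. by rewrite -evE limg_lfunVK// ev_full memvf. Qed.

Definition tens U V (u : U) (v : V) : tensor U V :=
  bilin (fun (xi : dual U) (eta : dual V) => (xi u * eta v : F^o)).

Lemma tensE U V (u : U) (v : V) xi eta : tens u v xi eta = xi u * eta v.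
Proof.
rewrite bilinE// => [f|f] a x y; rewrite add_lfunE scale_lfunE /=.
  by rewrite mulrDr mulrCA.
by rewrite mulrDl -mulrA.
Qed.

Lemma bilin_sum U V W (b : 'Hom(U, 'Hom(V, W))) m n
    (a : 'I_m -> F) (x : 'I_m -> U) (c : 'I_n -> F) (y : 'I_n -> V) :
  b (\sum_i a i *: x i) (\sum_j c j *: y j) =
  \sum_i \sum_j (a i * c j) *: b (x i) (y j).
Proof.
rewrite linear_sum exchange_big; apply: eq_bigr => j _.
rewrite linearZ linear_sum /= sum_lfunE scaler_sumr; apply: eq_bigr => i _.
by rewrite linearZ /= scale_lfunE scalerA mulrC.
Qed.

Lemma tensor_universal U V W (b : 'Hom(U, 'Hom(V, W))) :
  exists! t : 'Hom(tensor U V, W), forall u v, t (tens u v) = b u v.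
Proof.
pose eU := vbasis {:U}; pose eV := vbasis {:V}.
pose t0 (s : tensor U V) : W := \sum_(i < \dim {:U}) \sum_(j < \dim {:V})
  s (coordf i) (coordf j) *: b eU`_i eV`_j.
have t0_lin : linear t0.
  move=> a x y; rewrite scaler_sumr -big_split; apply: eq_bigr => i _ /=.
  rewrite scaler_sumr -big_split; apply: eq_bigr => j _ /=.
  by rewrite scalerA -scalerDl add_lfunE scale_lfunE add_lfunE scale_lfunE.
have t0_tens u v : t0 (tens u v) = b u v.
  rewrite [in RHS](sum_coordf u) [in RHS](sum_coordf v) bilin_sum.
  by apply: eq_bigr => i _; apply: eq_bigr => j _; rewrite tensE.
have tens_sum (s : tensor U V) : s = \sum_(i < \dim {:U}) \sum_(j < \dim {:V})
    s (coordf i) (coordf j) *: tens eU`_i eV`_j.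
  apply/lfunP => xi; apply/lfunP => eta; rewrite {1}(sum_dual xi) {1}(sum_dual eta).
  rewrite [LHS]bilin_sum !sum_lfunE; apply: eq_bigr => i _.
  rewrite !sum_lfunE; apply: eq_bigr => j _; rewrite !scale_lfunE.
  by rewrite tensE; apply: mulrC.
exists (linfun t0); split=> [u v|t tb]; first by rewrite linfun_val.
apply/lfunP => s; rewrite (tens_sum s) !linear_sum; apply: eq_bigr => i _.
rewrite !linear_sum; apply: eq_bigr => j _.
by rewrite !linearZ /= tb linfun_val// t0_tens.
Qed.

Definition Upsilon V (f : 'Hom(dual V, V)) : tensor V V := (ev V \o f)%VF.

Lemma UpsilonE V (f : 'Hom(dual V, V)) xi eta : Upsilon f xi eta = eta (f xi).
Proof. by rewrite comp_lfunE evE. Qed.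

Definition Upsilon_inv V (r : tensor V V) : 'Hom(dual V, V) :=
  ((ev V)^-1 \o r)%VF.

Lemma UpsilonK V : cancel (@Upsilon V) (@Upsilon_inv V).
Proof. by move=> f; apply/lfunP => x; rewrite !comp_lfunE lker0_lfunK// ev_inj. Qed.

Lemma Upsilon_invK V : cancel (@Upsilon_inv V) (@Upsilon V).
Proof.
by move=> r; apply/lfunP => x; rewrite !comp_lfunE limg_lfunVK// ev_full memvf.
Qed.

Definition symmetric_tensor V (r : tensor V V) : Prop :=
  forall xi eta, r xi eta = r eta xi.

End LinearAlgebra.

Section Leibniz.
Context {F : fieldType}.
Implicit Types g V W : vectType F.

Definition leibniz_identity g (br : 'Hom(g, 'End(g))) : Prop :=
  forall x y z, br x (br y z) = br (br x y) z + br y (br x z).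

Record leibniz g := Leibniz {
  lbr :> 'Hom(g, 'End(g));
  lbrP : leibniz_identity lbr }.

Definition commutator V (a b : 'End(V)) : 'End(V) := (a \o b)%VF - (b \o a)%VF.

Record representation g (h : leibniz g) V := Representation {
  rhoL : 'Hom(g, 'End(V));
  rhoR : 'Hom(g, 'End(V));
  rhoL_br : forall x y, rhoL (h x y) = commutator (rhoL x) (rhoL y);
  rhoR_br : forall x y, rhoR (h x y) = commutator (rhoL x) (rhoR y);
  rhoRL : forall x y, (rhoR y \o rhoL x)%VF = - (rhoR y \o rhoR x)%VF }.

Definition rep_star g V (rho : 'Hom(g, 'End(V))) : 'Hom(g, 'End(dual V)) :=
  bilin (fun x (chi : dual V) => - (chi \o rho x)%VF).

Lemma rep_starE g V (rho : 'Hom(g, 'End(V))) x chi :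
  rep_star rho x chi = - (chi \o rho x)%VF.
Proof.
rewrite bilinE// => [u|u] a y z.
  by rewrite comp_lfunDl -comp_lfunZl opprD scalerN.
by rewrite linearP comp_lfunDr -comp_lfunZr opprD scalerN.
Qed.

Definition lfunpE := (@comp_lfunE, @add_lfunE, @opp_lfunE, @scale_lfunE).

Lemma rep_starEE g V (rho : 'Hom(g, 'End(V))) x chi v :
  rep_star rho x chi v = - chi (rho x v).
Proof. by rewrite rep_starE opp_lfunE comp_lfunE. Qed.

Section DualRepresentation.
Context g (h : leibniz g) V (r : representation h V).

Local Notation sL := (rep_star (rhoL r)).
Local Notation sR := (- rep_star (rhoL r) - rep_star (rhoR r)).

Fact dual_rhoL_br x y : sL (h x y) = commutator (sL x) (sL y).
Proof.
apply/lfunP => chi; apply/lfunP => v; rewrite !(rep_starEE, lfunpE) rhoL_br.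
by rewrite !lfunpE linearB /= !opprK opprB.
Qed.

Fact dual_rhoR_br x y : sR (h x y) = commutator (sL x) (sR y).
Proof.
apply/lfunP => chi; apply/lfunP => v; rewrite !(rep_starEE, lfunpE).
rewrite rhoL_br rhoR_br !lfunpE !linearB /=.
ring.
Qed.

Fact dual_rhoRL x y : (sR y \o sL x)%VF = - (sR y \o sR x)%VF.
Proof.
apply/lfunP => chi; apply/lfunP => v; rewrite !(rep_starEE, lfunpE) !opprK.
have := congr1 (fun f : 'End(V) => chi (f v)) (rhoRL r y x).
rewrite /= !lfunpE linearN /= => ->.
ring.
Qed.

Definition dual_rep : representation h (dual V) :=
  Representation dual_rhoL_br dual_rhoR_br dual_rhoRL.

End DualRepresentation.

Section Semidirect.
Context g (h : leibniz g) V (r : representation h V).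

Definition semidirect_br : 'Hom((g * V)%type, 'End((g * V)%type)) :=
  bilin (fun p q : g * V =>
    (h p.1 q.1, rhoL r p.1 q.2 + rhoR r q.1 p.2) : (g * V)%type).

Lemma semidirect_brE p q :
  semidirect_br p q = (h p.1 q.1, rhoL r p.1 q.2 + rhoR r q.1 p.2).
Proof.
rewrite bilinE// => u a x y /=; congr (_, _).
- by rewrite linearP.
- rewrite !linearP /= lfunpE scale_lfunE; apply: dual_ext => chi.
  rewrite !(linearD, linearZ) /= /GRing.scale /=; ring.
- by rewrite linearP /= lfunpE scale_lfunE.
- rewrite !linearP /= lfunpE scale_lfunE; apply: dual_ext => chi.
  rewrite !(linearD, linearZ) /= /GRing.scale /=; ring.
Qed.

Fact semidirect_leibniz : leibniz_identity semidirect_br.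
Proof.
move=> [x u] [y v] [z w]; rewrite !semidirect_brE /=; congr (_, _).
  exact: lbrP.
rewrite rhoL_br !rhoR_br !lfunpE !linearD /=.
have := congr1 (fun f : 'End(V) => f u) (rhoRL r y z); rewrite /= !lfunpE => ->.
have abel (a a' b c d e : V) :
    a + b + (c - - e) = (a - a') + (d + e) + (a' + c + (b - d)).
  by apply: dual_ext => chi; rewrite !(linearD, linearN) /=; ring.
exact: abel.
Qed.

Definition semidirect : leibniz (g * V)%type := Leibniz semidirect_leibniz.

End Semidirect.

Section Regular.
Context g (h : leibniz g).

Definition left_mul : 'Hom(g, 'End(g)) := h.
Definition right_mul : 'Hom(g, 'End(g)) := bilin (fun x y => h y x).

Lemma right_mulE x y : right_mul x y = h y x.
Proof.
rewrite bilinE// => u a z t; last by rewrite linearP.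
by rewrite linearP /= lfunpE scale_lfunE.
Qed.

Lemma leibniz_antisym x y z : h (h x y) z = - h (h y x) z.
Proof.
have := lbrP h x y z; rewrite (lbrP h y x z) addrA => /eqP.
rewrite -{1}[h x (h y z)]add0r (inj_eq (addIr _)) eq_sym addr_eq0.
by move/eqP.
Qed.

Fact left_mul_br x y : left_mul (h x y) = commutator (left_mul x) (left_mul y).
Proof. by apply/lfunP => z; rewrite /commutator !lfunpE /left_mul lbrP addrK. Qed.

Fact right_mul_br x y : right_mul (h x y) = commutator (left_mul x) (right_mul y).
Proof.
apply/lfunP => z; rewrite /commutator !(right_mulE, lfunpE) /left_mul lbrP.
by rewrite leibniz_antisym addrC.
Qed.

Fact right_left_mul x y :
  (right_mul y \o left_mul x)%VF = - (right_mul y \o right_mul x)%VF.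
Proof.
by apply/lfunP => z; rewrite !(right_mulE, lfunpE) /left_mul leibniz_antisym.
Qed.

Definition regular : representation h g :=
  Representation left_mul_br right_mul_br right_left_mul.

End Regular.

(* Transport of a representation on V to W along an isomorphism i : W -> V.  The
   axioms only need i to be onto; the one instance used below, dual_sum, is
   bijective (dual_sum_inj, dual_sum_full). *)
Section Transport.
Context g (h : leibniz g) V (r : representation h V) W (i : 'Hom(W, V)).
Hypothesis i_full : limg i = fullv.

Definition conj_rho (rho : 'Hom(g, 'End(V))) : 'Hom(g, 'End(W)) :=
  bilin (fun x w => (i^-1)%VF (rho x (i w))).

Lemma conj_rhoE rho x w : conj_rho rho x w = (i^-1)%VF (rho x (i w)).
Proof.
rewrite bilinE// => u a y z; first by rewrite !linearP.
by rewrite linearP lfunpE scale_lfunE linearP.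
Qed.

Let iVK v : i ((i^-1)%VF v) = v.
Proof. by rewrite limg_lfunVK// i_full memvf. Qed.

Fact transport_rhoL_br x y :
  conj_rho (rhoL r) (h x y) = commutator (conj_rho (rhoL r) x) (conj_rho (rhoL r) y).
Proof.
apply/lfunP => w; rewrite /commutator !(conj_rhoE, lfunpE) rhoL_br /commutator !lfunpE.
by rewrite linearB /= !iVK.
Qed.

Fact transport_rhoR_br x y :
  conj_rho (rhoR r) (h x y) = commutator (conj_rho (rhoL r) x) (conj_rho (rhoR r) y).
Proof.
apply/lfunP => w; rewrite /commutator !(conj_rhoE, lfunpE) rhoR_br /commutator !lfunpE.
by rewrite linearB /= !iVK.
Qed.

Fact transport_rhoRL x y :
  (conj_rho (rhoR r) y \o conj_rho (rhoL r) x)%VF =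
  - (conj_rho (rhoR r) y \o conj_rho (rhoR r) x)%VF.
Proof.
apply/lfunP => w; rewrite !(conj_rhoE, lfunpE) !iVK -linearN; congr ((i^-1)%VF _).
by have := congr1 (fun f : 'End(V) => f (i w)) (rhoRL r x y); rewrite /= !lfunpE.
Qed.

Definition transport_rep : representation h W :=
  Representation transport_rhoL_br transport_rhoR_br transport_rhoRL.

End Transport.

Definition relative_rota_baxter g (h : leibniz g) V (r : representation h V)
    (K : 'Hom(V, g)) : Prop :=
  forall v1 v2,
    h (K v1) (K v2) = K (rhoL r (K v1) v2 + rhoR r (K v2) v1).

Definition dual_map V W (K : 'Hom(V, W)) : 'Hom(dual W, dual V) :=
  linfun (fun xi : dual W => (xi \o K)%VF : dual V).

Lemma dual_mapE V W (K : 'Hom(V, W)) xi v : dual_map K xi v = xi (K v).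
Proof.
rewrite linfun_val ?comp_lfunE// => a x y.
by rewrite comp_lfunDl -comp_lfunZl.
Qed.

(* The identification of g^* (+) V with (g (+) V^* )^*:
   <xi + v, x + chi> = <xi, x> + <chi, v>. *)
Section DualSum.
Context g V.

Definition dual_sum : 'Hom((dual g * V)%type, dual (g * dual V)%type) :=
  bilin (fun (p : dual g * V) (q : g * dual V) => (p.1 q.1 + q.2 p.2 : F^o)).

Lemma dual_sumE p q : dual_sum p q = p.1 q.1 + q.2 p.2.
Proof.
rewrite bilinE// => u a x y /=.
  by rewrite linearP /= lfunpE scale_lfunE scalerDr addrACA.
by rewrite linearP /= lfunpE scale_lfunE scalerDr addrACA.
Qed.

Lemma dual_sum_inj : lker dual_sum == 0%VS.
Proof.
apply/lker0P => -[xi u] [eta v] /lfunP E; congr (_, _).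
  by apply/lfunP => x; have := E (x, 0); rewrite !dual_sumE /= !zero_lfunE !addr0.
by apply: dual_ext => chi; have := E (0, chi); rewrite !dual_sumE /= !linear0 !add0r.
Qed.

Lemma dual_sum_full : limg dual_sum = fullv.
Proof.
apply/eqP; rewrite eqEsubv subvf; apply/subvP => f _; apply/memv_imgP.
pose xi : dual g := linfun (fun x => f (x, 0)).
pose phi : dual (dual V) := linfun (fun chi => f (0, chi)).
exists (xi, (ev V)^-1%VF phi); first exact: memvf.
apply/lfunP => -[x chi]; rewrite dual_sumE /= ev_invE.
rewrite !linfun_val.
- by rewrite -linearD; congr (f (_, _)); rewrite ?addr0 ?add0r.
- move=> a s t; rewrite -linearP; congr (f (_, _)).
  by rewrite /= scaler0 addr0.
- move=> a s t; rewrite -linearP; congr (f (_, _)).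
  by rewrite /= scaler0 addr0.
Qed.

End DualSum.

(* The map K + K^* *)
Definition sum_dual_map g V (K : 'Hom(V, g)) :
    'Hom((dual g * V)%type, (g * dual V)%type) :=
  linfun (fun p : dual g * V => (K p.2, dual_map K p.1) : (g * dual V)%type).

Lemma sum_dual_mapE g V (K : 'Hom(V, g)) p :
  sum_dual_map K p = (K p.2, dual_map K p.1).
Proof. by rewrite linfun_val// => a x y /=; rewrite !linearP. Qed.

Section YangBaxter.
Context g (h : leibniz g).

Local Notation Ls := (rep_star (rhoL (regular h))).
Local Notation Rs := (rep_star (rhoR (regular h))).

Definition yb_bracket (f f' : 'Hom(dual g, g)) (xi1 xi2 : dual g) : g :=
  - f (Ls (f' xi1) xi2) + f (Ls (f' xi2) xi1) + f (Rs (f' xi2) xi1)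
  + h (f' xi1) (f xi2) + h (f xi1) (f' xi2)
  - f' (Ls (f xi1) xi2) + f' (Ls (f xi2) xi1) + f' (Rs (f xi2) xi1).

(* [[r, s]], as given by yb_tensorE: Upsilon is bijective, with inverse
   Upsilon_inv, so r and s are of the form Upsilon f and Upsilon f'. *)
Definition yb_tensor (r s : tensor g g) : tensor3 g g g :=
  bilin (fun xi1 xi2 => ev g (yb_bracket (Upsilon_inv r) (Upsilon_inv s) xi1 xi2)).

Lemma yb_tensorE f f' xi1 xi2 xi3 :
  yb_tensor (Upsilon f) (Upsilon f') xi1 xi2 xi3 = xi3 (yb_bracket f f' xi1 xi2).
Proof.
have linD (U W : vectType F) (a b : U -> W) :
    linear a -> linear b -> linear (fun x => a x + b x).
  by move=> la lb c x y; rewrite la lb scalerDr addrACA.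
have linN (U W : vectType F) (a : U -> W) : linear a -> linear (fun x => - a x).
  by move=> la c x y; rewrite la scalerN opprD.
rewrite /yb_tensor !UpsilonK bilinE ?evE// => u a x y.
  rewrite -linearP; congr (ev g _); move: a x y; rewrite /yb_bracket.
  by repeat first [apply: (@linD) | apply: (@linN)]; move=> a x y;
    rewrite !linearP ?lfunpE ?scale_lfunE ?linearP.
rewrite -linearP; congr (ev g _); move: a x y; rewrite /yb_bracket.
by repeat first [apply: (@linD) | apply: (@linN)]; move=> a x y;
    rewrite !linearP ?lfunpE ?scale_lfunE ?linearP.
Qed.

Definition yang_baxter_solution (r : tensor g g) : Prop :=
  symmetric_tensor r /\ yb_tensor r r = 0.

End YangBaxter.

End Leibniz.

(* Main.v *)
Require Import Defs.
From HB Require Import structures.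
From mathcomp Require Import all_boot all_order all_algebra.
From mathcomp Require Import ring.
Set Implicit Arguments.
Unset Strict Implicit.
Unset Printing Implicit Defensive.
Import GRing.Theory.
Local Open Scope ring_scope.

(* Let D(v1, v2) = [Kv1, Kv2] - K(rhoL(Kv1)v2 + rhoR(Kv2)v1) be the defect of
   the Rota-Baxter identity for K.  The map K + K^* is symmetric for the pairing
   of g^* (+) V with g (+) V^*, so its own defect at xi1 + v1, xi2 + v2, paired
   with xi3 + v3, unfolds to
     <xi3, D(v1, v2)> + <xi2, D(v1, v3)> - <xi1, D(v2, v3) + D(v3, v2)>,
   and both defects vanish together.  For f = K + K^* regarded as a map
   h^* -> h, the bracket {f, f} is twice the defect of f, and 2 is invertible. *)

Section LinearAlgebra.
Context {F : fieldType} (g V : vectType F).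

Lemma dual_sumK : cancel (dual_sum g V) (dual_sum g V)^-1%VF.
Proof. by move=> p; rewrite lker0_lfunK ?dual_sum_inj. Qed.

Lemma dual_sumVK : cancel (dual_sum g V)^-1%VF (dual_sum g V).
Proof. by move=> xi; rewrite limg_lfunVK ?dual_sum_full ?memvf. Qed.

(** Every functional on g (+) V^* comes from the pairing, since [dual_sum] is onto, and functionals
    separate points. *)
Lemma dual_sum_ext (a b : (g * dual V)%type) :
  (forall p, dual_sum g V p a = dual_sum g V p b) -> a = b.
Proof. by move=> ab; apply: dual_ext => xi; rewrite -(dual_sumVK xi). Qed.

Lemma sum_dual_map_sym (K : 'Hom(V, g)) p q :
  dual_sum g V q (sum_dual_map K p) = dual_sum g V p (sum_dual_map K q).
Proof. by rewrite !dual_sumE !sum_dual_mapE /= !dual_mapE addrC. Qed.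

Lemma symmetric_sum_dual_map (K : 'Hom(V, g)) :
  symmetric_tensor (Upsilon (sum_dual_map K \o (dual_sum g V)^-1)%VF).
Proof.
move=> xi eta; rewrite !UpsilonE !comp_lfunE.
by rewrite -{1}(dual_sumVK eta) sum_dual_map_sym dual_sumVK.
Qed.

End LinearAlgebra.

Section RotaBaxter.
Context {F : fieldType} (g : vectType F) (h : leibniz g).

Definition rota_baxter_defect (V : vectType F) (r : representation h V)
    (K : 'Hom(V, g)) v1 v2 :=
  h (K v1) (K v2) - K (rhoL r (K v1) v2 + rhoR r (K v2) v1).

Lemma relative_rota_baxterP (V : vectType F) (r : representation h V)
    (K : 'Hom(V, g)) :
  relative_rota_baxter r K <-> forall v1 v2, rota_baxter_defect r K v1 v2 = 0.
Proof.
by split=> E v1 v2; apply/eqP; move/eqP: (E v1 v2); rewrite subr_eq0.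
Qed.

(** The transported action is conjugation by [i], so substituting [v = i w] matches the two
    identities. This moves [sum_dual_map K] to the full dual of g (+) V^*, the domain that [Upsilon]
    requires. *)
Lemma relative_rota_baxter_transport (V W : vectType F) (r : representation h V)
    (i : 'Hom(W, V)) (i_full : limg i = fullv) (K : 'Hom(W, g)) :
  lker i == 0%VS ->
  relative_rota_baxter (transport_rep r i_full) K <->
  relative_rota_baxter r (K \o i^-1)%VF.
Proof.
move=> i_inj.
have iVK v : i ((i^-1)%VF v) = v by rewrite limg_lfunVK// i_full memvf.
split=> E v1 v2.
  rewrite !comp_lfunE E /= !conj_rhoE !iVK; congr (K _).
  by rewrite linearD.
have := E (i v1) (i v2); rewrite !comp_lfunE !(lker0_lfunK i_inj) => ->.
by rewrite /= !conj_rhoE linearD.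
Qed.

Lemma defect_pairing (V : vectType F) (r : representation h V)
    (K : 'Hom(V, g)) (xi : dual g) v1 v2 :
  xi (rota_baxter_defect r K v1 v2) =
  xi (h (K v1) (K v2)) - xi (K (rhoL r (K v1) v2)) - xi (K (rhoR r (K v2) v1)).
Proof. by rewrite linearB /= !linearD /= addrA. Qed.

(** The signs in -L^* - R^* cancel those in the definition of the dual action, hence two positive
    terms. *)
Lemma dual_regular_pairing x y z (xi eta : dual g) :
  (rhoL (dual_rep (regular h)) x eta + rhoR (dual_rep (regular h)) y xi) z =
  - eta (h x z) + xi (h y z) + xi (h z y).
Proof.
by rewrite /= !(lfunpE, rep_starEE) /= right_mulE !opprK addrA.
Qed.

Lemma yb_bracket_diag (f : 'Hom(dual g, g)) xi1 xi2 :
  yb_bracket h f f xi1 xi2 =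
  rota_baxter_defect (dual_rep (regular h)) f xi1 xi2 *+ 2.
Proof.
rewrite /yb_bracket /rota_baxter_defect /= !add_lfunE !opp_lfunE.
rewrite !linearD !linearN /=.
(* Pairing with [chi] turns an identity in g into one between scalars, where [ring] applies. *)
apply: dual_ext => chi; rewrite linearMn /= !(linearD, linearN) /=; ring.
Qed.

Lemma yb_tensor_diag_eq0 (f : 'Hom(dual g, g)) : 2 != 0 :> F ->
  yb_tensor h (Upsilon f) (Upsilon f) = 0 <->
  relative_rota_baxter (dual_rep (regular h)) f.
Proof.
move=> two_neq0; rewrite relative_rota_baxterP; split=> [E xi1 xi2|E].
  apply: dual_ext => xi3.
  have := yb_tensorE h f f xi1 xi2 xi3.
  rewrite E !zero_lfunE yb_bracket_diag linearMn /= -mulr_natl => /esym/eqP.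
  by rewrite mulf_eq0 (negPf two_neq0) /= linear0 => /eqP.
apply/lfunP => xi1; apply/lfunP => xi2; apply/lfunP => xi3.
by rewrite yb_tensorE yb_bracket_diag E mul0rn linear0 !zero_lfunE.
Qed.

End RotaBaxter.

Section Coregular.
Context {F : fieldType} (g V : vectType F) (h : leibniz g).
Context (r : representation h V) (K : 'Hom(V, g)).

Local Notation gV := (semidirect (dual_rep r)).
Local Notation coregular :=
  (transport_rep (dual_rep (regular gV)) (dual_sum_full g V)).
Local Notation T := (sum_dual_map K).
Local Notation D := (rota_baxter_defect r K).

(** Four instances of this trilinear form, with the arguments permuted, make up the paired defect of
    [T]. *)
Lemma dual_sum_semidirect (p q s : (dual g * V)%type) :
  dual_sum g V p (gV (T q) (T s)) =
  p.1 (h (K q.2) (K s.2)) - s.1 (K (rhoL r (K q.2) p.2))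
  + q.1 (K (rhoL r (K s.2) p.2)) + q.1 (K (rhoR r (K s.2) p.2)).
Proof.
rewrite dual_sumE !sum_dual_mapE semidirect_brE /=.
rewrite !(rep_starEE, lfunpE) !dual_mapE; ring.
Qed.

Lemma dual_sum_defect (p1 p2 p3 : (dual g * V)%type) :
  dual_sum g V p3 (rota_baxter_defect coregular T p1 p2) =
  p3.1 (D p1.2 p2.2) + p2.1 (D p1.2 p3.2)
  - p1.1 (D p2.2 p3.2 + D p3.2 p2.2).
Proof.
(* [w] is the argument of [T] in the defect, seen as a functional on g (+) V^*. *)
pose w := rhoL (dual_rep (regular gV)) (T p1) (dual_sum g V p2) +
  rhoR (dual_rep (regular gV)) (T p2) (dual_sum g V p1).
have wE z : w z = _ := dual_regular_pairing gV (T p1) (T p2) z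
  (dual_sum g V p1) (dual_sum g V p2).
have -> : rota_baxter_defect coregular T p1 p2 =
    gV (T p1) (T p2) - T ((dual_sum g V)^-1%VF w).
  by rewrite /rota_baxter_defect !conj_rhoE [in RHS]linearD.
clearbody w.
(* Symmetry of [T] trades the preimage of [w] for [p3], leaving [w] evaluated at [T p3]. *)
rewrite linearB /= (sum_dual_map_sym K _ p3) dual_sumVK wE.
rewrite !dual_sum_semidirect [p1.1 (_ + _)]linearD /= !defect_pairing; ring.
Qed.

Lemma relative_rota_baxter_coregular :
  relative_rota_baxter r K <-> relative_rota_baxter coregular T.
Proof.
rewrite !relative_rota_baxterP; split=> E.
  move=> p1 p2; apply: dual_sum_ext => p3.
  by rewrite dual_sum_defect !E addr0 !linear0 !addr0.
move=> v1 v2; apply: dual_ext => xi.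
(* With these zero components only the term [xi (D v1 v2)] survives. *)
have := dual_sum_defect (0, v1) (0, v2) (xi, 0).
by rewrite E /= !zero_lfunE !linear0 !addr0 => ->.
Qed.

End Coregular.

Theorem theorem5p2 (F : closedFieldType) (charF0 : [pchar F] =i pred0)
    (g V : vectType F) (h : leibniz g) (r : representation h V)
    (K : 'Hom(V, g)) :
  let gV : leibniz (g * dual V)%type := semidirect (dual_rep r) in
  let coregular : representation gV (dual g * V)%type :=
    transport_rep (dual_rep (regular gV)) (dual_sum_full g V) in
  (relative_rota_baxter r K <->
     relative_rota_baxter coregular (sum_dual_map K)) /\
  (relative_rota_baxter coregular (sum_dual_map K) <->
     yang_baxter_solution gV
       (Upsilon (sum_dual_map K \o (dual_sum g V)^-1)%VF)).
Proof.
move=> gV coregular; split; first exact: relative_rota_baxter_coregular.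
have two_neq0 : 2 != 0 :> F by rewrite ((pcharf0P F).1 charF0).
rewrite relative_rota_baxter_transport ?dual_sum_inj// -yb_tensor_diag_eq0//.
(* The symmetry half of [yang_baxter_solution] holds for every [K]. *)
by split=> [E|[]//]; split=> //; apply: symmetric_sum_dual_map.
Qed.
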